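(* Let $(X,d)$ be a pseudosemimetric space and suppose there exists an $\varepsilon>0$ such that for every $z\in X$ the triangle inequality $$d(x,y)\leqslant d(x,z)+d(z,y)$$ holds for every $x,y\in B_{\varepsilon}(z)$. Then the sets $$U_a=\{(x,y)\in X\times X\colon d(x,y)\leqslant a\},\qquad a>0,$$ form a fundamental system of entourages of some uniformity on $X$.
   Context: A pseudosemimetric space is a pair $(X,d)$ where $X$ is a set and $d\colon X\times X\to[0,\infty)$ satisfies $d(x,y)=d(y,x)$ and $d(x,x)=0$ for all $x,y\in X$. Here $B_{\varepsilon}(z)=\{x\in X\colon d(x,z)<\varepsilon\}$. A non-empty set $\mathfrak B$ of subsets of $X\times X$ is a fundamental system of entourages of a uniformity on $X$ if and only if: (B1) the intersection of two sets of $\mathfrak B$ contains a set of $\mathfrak B$; (B2) every set of $\mathfrak B$ contains the diagonal $\Delta=\{(x,x)\mid x\in X\}$; (B3) for each $V\in\mathfrak B$ there exists $V'\in\mathfrak B$ with $V'\subseteq V^{-1}$; (B4) for each $V\in\mathfrak B$ there exists $W\in\mathfrak B$ with $W^2\subseteq V$. Here $V^{-1}=\{(x,y)\mid(y,x)\in V\}$ and $W^2$ is the set of pairs $(x,y)$ such that $(x,z),(z,y)\in W$ for some $z\in X$. *)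

(* Defs.v *)
From mathcomp Require Import all_boot all_order all_algebra.
From mathcomp Require Import all_classical all_reals topology.

Set Implicit Arguments.
Unset Strict Implicit.
Unset Printing Implicit Defensive.

Import Order.TTheory GRing.Theory Num.Theory.

Local Open Scope classical_set_scope.
Local Open Scope ring_scope.

Record pseudosemimetric (R : realType) (X : Type) (d : X -> X -> R) : Prop :=
  { psm_ge0 : forall x y, 0 <= d x y;
    psm_sym : forall x y, d x y = d y x;
    psm_refl : forall x, d x x = 0 }.

(* MathComp-Analysis's [ball] needs a structure on [X] whose triangle
   inequality holds everywhere, so the open ball of [d] is defined directly. *)
Definition psm_ball (R : realType) (X : Type) (d : X -> X -> R)
    (e : R) (z : X) : set X :=
  [set x | d x z < e].

Definition psm_entourage (R : realType) (X : Type) (d : X -> X -> R)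
    (a : R) : set (X * X) :=
  [set xy | d xy.1 xy.2 <= a].

(* Bourbaki's sense: a set of entourages of which every entourage contains a
   member.  As [setT] is an entourage, [B] is then nonempty.  A
   [Uniform.axioms_ X] is a uniform structure on the bare type [X]. *)
Definition fundamental_system_of_entourages (X : Type)
    (U : Uniform.axioms_ X) (B : set (set (X * X))) : Prop :=
  B `<=` @entourage (Uniform.Pack U) /\
  forall V, @entourage (Uniform.Pack U) V -> exists2 W, B W & W `<=` V.

(* Main.v *)
Require Import Defs.
From HB Require Import structures.
From mathcomp Require Import all_boot all_order all_algebra.
From mathcomp Require Import all_classical all_reals topology.

Set Implicit Arguments.
Unset Strict Implicit.
Unset Printing Implicit Defensive.

Import Order.TTheory GRing.Theory Num.Theory.

Local Open Scope classical_set_scope.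
Local Open Scope ring_scope.

(** By Bourbaki's criterion a nonempty family of relations is a fundamental
system of entourages as soon as it is directed downwards, consists of reflexive
relations, and contains a refinement of the inverse and a square root of each
of its members ([fundamental_system_of_entourages_exists]).  For the sets
[psm_entourage d a] everything except the square root is immediate: they
increase with [a], they are reflexive because [d x x = 0], and they are
symmetric because [d] is.  The square root only involves pairs [(x, y)] with a
midpoint [z] to which both are close; once the scale is chosen smaller than the
radius [e], both points lie in the ball of radius [e] around [z], where the
triangle inequality is available, so half the scale is a square root
([psm_entourage_comp_sub]). *)

(** The uniformity is the upward closure of [B], and the four conditions on [B]
pass to it one by one. *)
Lemma fundamental_system_of_entourages_exists (X : Type)
    (B : set (set (X * X))) :
    B !=set0 ->
    (forall V W, B V -> B W -> exists2 U, B U & U `<=` V `&` W) ->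
    (forall V, B V -> diagonal `<=` V) ->
    (forall V, B V -> exists2 W, B W & W `<=` V^-1%relation) ->
    (forall V, B V -> exists2 W, B W & (W \; W)%relation `<=` V) ->
  exists U : Uniform.axioms_ X, fundamental_system_of_entourages U B.
Proof.
move=> B0 BI Bdiag Binv Bsplit.
pose ent : set_system (X * X) := filter_from B id.
have entF : Filter ent by exact: filter_from_filter.
have ent_diag A : ent A -> diagonal `<=` A.
  by case=> V BV VA; apply: subset_trans VA; exact: Bdiag.
have ent_inv A : ent A -> ent A^-1%relation.
  case=> V /Binv[W BW WV] VA; exists W => //.
  by move=> p /WV; exact: VA.
have ent_split A : ent A -> exists2 C, ent C & (C \; C)%relation `<=` A.
  case=> V /Bsplit[W BW WV] VA.
  by exists W; [exists W | exact: subset_trans VA].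
(* [X] is a bare type, possibly empty, so its decidable equality and its choice
   operator are the classical ones carried by [{classic X}]. *)
pose m := isUniform.Build {classic X} entF ent_diag ent_inv ent_split.
pose T : uniformType := HB.pack {classic X} m.
by exists (Uniform.class T); split=> [V BV|//]; exists V.
Qed.

Lemma psm_entourage_subset (R : realType) (X : Type) (d : X -> X -> R)
    (a b : R) : a <= b -> psm_entourage d a `<=` psm_entourage d b.
Proof. by move=> ab p /= dp; exact: le_trans ab. Qed.

(** [b < e] puts [x] and [y] in the open ball of radius [e] around any [z] that
witnesses [(x, y)] in the composite, which is where the local triangle
inequality applies. *)
Lemma psm_entourage_comp_sub (R : realType) (X : Type) (d : X -> X -> R)
    (e b : R) :
    pseudosemimetric d ->
    (forall z x y : X, psm_ball d e z x -> psm_ball d e z y ->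
       d x y <= d x z + d z y) ->
    b < e ->
  (psm_entourage d b \; psm_entourage d b)%relation `<=`
    psm_entourage d (b + b).
Proof.
move=> hd htri be [x y] /= [z dxz dzy].
rewrite /psm_entourage /= in dxz dzy *.
apply: le_trans (htri z x y _ _) (lerD dxz dzy); rewrite /psm_ball /=.
  exact: le_lt_trans be.
by rewrite (psm_sym hd); exact: le_lt_trans be.
Qed.

Theorem theorem4p7 (R : realType) (X : Type) (d : X -> X -> R)
    (hd : pseudosemimetric d)
    (htri : exists2 e : R, 0 < e &
       forall z x y : X, psm_ball d e z x -> psm_ball d e z y ->
         d x y <= d x z + d z y) :
  exists U : Uniform.axioms_ X,
    fundamental_system_of_entourages U
      [set psm_entourage d a | a in [set a : R | 0 < a]].
Proof.
case: htri => e e0 htri.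
apply: fundamental_system_of_entourages_exists.
- by exists (psm_entourage d 1), 1 => //=.
- move=> _ _ [a a0 <-] [b b0 <-].
  exists (psm_entourage d (Num.min a b)).
    by exists (Num.min a b) => //=; rewrite lt_min; apply/andP.
  by rewrite subsetI; split; apply: psm_entourage_subset;
    rewrite ge_min lexx ?orbT.
- move=> _ [a a0 <-] [x y]; rewrite /diagonal /psm_entourage /= => ->.
  by rewrite (psm_refl hd) ltW.
- move=> _ [a a0 <-]; exists (psm_entourage d a); first by exists a.
  by move=> [x y] /=; rewrite /psm_entourage /= (psm_sym hd).
- move=> _ [a a0 <-].
  (* Halving the minimum of [a] and [e] makes the sum of two scales at most [a], and each of
     them strictly less than [e]. *)
  have c0 : 0 < Num.min a e by rewrite lt_min; apply/andP.
  have ce : Num.min a e / 2 < e.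
    apply: (@lt_le_trans _ _ (Num.min a e)); last by rewrite ge_min lexx orbT.
    by rewrite ltr_pdivrMr// ltr_pMr// ltr1n.
  exists (psm_entourage d (Num.min a e / 2)).
    by exists (Num.min a e / 2) => //=; exact: divr_gt0.
  apply: subset_trans (psm_entourage_comp_sub hd htri ce) _.
  by apply: psm_entourage_subset; rewrite -splitr ge_min lexx.
Qed.
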